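(* Let $n\ge 1$ be an integer and let $a_0,a_1,a_2\ge 0$ be real numbers. Set $f(x)=a_0+a_1\sigma_1(x)+a_2\sigma_2(x)$ for $x\in\mathbb{R}^n$, and $\bar f(X)=f(X,\ldots,X)=a_0\binom{n}{0}+a_1\binom{n}{1}X+a_2\binom{n}{2}X^2\in\mathbb{R}[X]$. Then the function $\sqrt{f}$ is concave on $\Gamma_n=(0,\infty)^n$ if and only if $\bar f$ is real-rooted. In other words, $$\sqrt{a_0+a_1\sigma_1+a_2\sigma_2}\ \text{ is concave on } (0,\infty)^n \iff n a_1^2-2(n-1)a_0a_2\ge 0.$$
   Context: $\sigma_k(x)=\sum_{i_1<\cdots<i_k}x_{i_1}\cdots x_{i_k}$ is the $k$-th elementary symmetric polynomial in the coordinates of $x$ ($\sigma_0=1$, and $\sigma_k=0$ if $k$ exceeds the number of variables). A real polynomial is real-rooted if all its complex roots are real; constant polynomials (including the zero polynomial) are counted as real-rooted. *)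

(* Defs.v *)
From mathcomp Require Import all_boot all_order all_algebra.
From mathcomp Require Import classical_sets reals convex.
From mathcomp Require Import complex.
(* The notations of mpoly clash with those of the analysis libraries. *)
From mathcomp Require Import -(notations) mpoly.

Set Implicit Arguments.
Unset Strict Implicit.
Unset Printing Implicit Defensive.

Import Order.TTheory GRing.Theory Num.Theory.

Local Open Scope classical_set_scope.
Local Open Scope ring_scope.

(* The polynomial a0 + a1 sigma_1 + a2 sigma_2 in n variables; since
   [mesym n R k] is a sum over the k-subsets of 'I_n, it is 1 for k = 0 and 0
   for k > n. *)
Definition quad_sym (R : realType) (n : nat) (a0 a1 a2 : R) : mpoly n R :=
  a0 *: mesym n R 0 + a1 *: mesym n R 1 + a2 *: mesym n R 2.

Definition mpoly_fun (R : realType) (n : nat) (p : mpoly n R)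
  (x : 'rV[R]_n) : R := meval (fun i => x ord0 i) p.

(* p(X, ..., X). *)
Definition diag_poly (R : realType) (n : nat) (p : mpoly n R) : {poly R} :=
  mmap (@polyC R) (fun=> 'X) p.

(* Constants are treated apart because every complex number is a root of the
   zero polynomial. *)
Definition real_rooted (R : realType) (p : {poly R}) : Prop :=
  (size p <= 1)%N \/
  forall z : complex R,
    root (map_poly (real_complex R) p) z -> complex.Im z = 0.

Definition pos_orthant (R : realType) (n : nat) : set 'rV[R]_n :=
  [set x | forall i, 0 < x ord0 i].

Definition concave_on (R : realType) (n : nat) (D : set 'rV[R]_n)
  (g : 'rV[R]_n -> R) : Prop :=
  @convex_function R 'rV[R]_n D (fun x => - g x).

(* Main.v *)
(** Write [s] for the sum and [q] for the sum of squares of the coordinates of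
    [x], so that [f x = a0 + a1 s + a2 / 2 (s^2 - q)]. Let [B] be the symmetric
    bilinear form in [(1, x)], [(1, y)] with [B x x = f x]. Expanding
    [f (t x + (1 - t) y)], concavity of [sqrt f] is the reversed Cauchy-Schwarz
    inequality [B x x * B y y <= (B x y)^2] on the orthant. On the diagonal
    the defect [(B x y)^2 - B x x * B y y] is a multiple of the discriminant of
    [fbar], which gives necessity. For sufficiency, split [x] and [y] into
    their diagonal parts and the centred remainders [u], [v]: the diagonal
    parts satisfy the reversed inequality by the discriminant condition, and
    [B] subtracts from them [a2 / 2 <u, v>], which obeys the usual
    Cauchy-Schwarz inequality. *)
Require Import Defs.
From mathcomp Require Import all_boot all_order all_algebra.
From mathcomp Require Import classical_sets reals.
From mathcomp Require Import interval_inference convex complex.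
From mathcomp Require Import ring lra.
From mathcomp Require Import -(notations) mpoly.

Import Order.TTheory GRing.Theory Num.Theory.
Local Open Scope ring_scope.

(** * Elementary symmetric polynomials and their diagonal restriction *)

(** Newton's identity in degree 2, by induction on the number of variables: the cross term of the
    square, twice the old [sigma_1] times the new variable, is what [2 sigma_2] gains. *)
Lemma mesym1_sqr (R : comNzRingType) (n : nat) :
  mesym n R 1 ^+ 2 = \sum_(i < n) mpolyX R (mnm1 i) ^+ 2 + mesym n R 2 *+ 2.
Proof.
elim: n => [|n IHn].
  by rewrite mesym1E !big_ord0 mesym_geqnE // mul0rn addr0 expr0n.
rewrite !mesymSS mesym0E rmorph1 mul1r sqrrD -rmorphXn IHn big_ord_recr /=.
rewrite rmorphD rmorph_sum rmorphMn /=.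
under [in LHS]eq_bigr => i _ do rewrite rmorphXn /= mwidenX mnmwiden1.
by rewrite mulrnDl [RHS]addrAC [in RHS]addrA.
Qed.

Lemma diag_poly_mesym (R : realType) (n k : nat) :
  diag_poly (mesym n R k) = 'C(n, k)%:R *: 'X^k.
Proof.
rewrite /diag_poly /mesym raddf_sum /=.
under eq_bigr => h hk.
  rewrite rmorph_prod /=; under eq_bigr => i _ do rewrite mmapX mmap1U.
  rewrite prodr_const (eqP hk); over.
rewrite sumr_const scaler_nat; congr (_ *+ _).
by have := card_draws 'I_n k; rewrite card_ord => <-; apply: eq_card => h;
  rewrite !inE.
Qed.

Lemma diag_poly_quad_sym (R : realType) (n : nat) (a0 a1 a2 : R) :
  diag_poly (quad_sym n a0 a1 a2) =
  (a0 * 'C(n, 0)%:R)%:P + (a1 * 'C(n, 1)%:R) *: 'X + (a2 * 'C(n, 2)%:R) *: 'X^2.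
Proof.
rewrite /diag_poly /quad_sym !mmapD !mmapZ -!/(diag_poly _) !diag_poly_mesym.
by rewrite !mul_polyC !scalerA expr0 expr1 alg_polyC.
Qed.

(** * The polar form of [f] and Cauchy-Schwarz for centred vectors *)

Section Polarization.
Context {R : realType} {n : nat}.
Implicit Types (x y : 'rV[R]_n) (a : R).

Definition vsum x : R := \sum_i x ord0 i.
Definition vdot x y : R := \sum_i x ord0 i * y ord0 i.

Definition quad_polar a0 a1 a2 x y : R :=
  a0 + a1 / 2 * (vsum x + vsum y) + a2 / 2 * (vsum x * vsum y - vdot x y).

Lemma vsumD x y : vsum (x + y) = vsum x + vsum y.
Proof. by rewrite /vsum -big_split; apply: eq_bigr => i _; rewrite mxE. Qed.

Lemma vsumZ a x : vsum (a *: x) = a * vsum x.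
Proof. by rewrite /vsum big_distrr; apply: eq_bigr => i _; rewrite mxE. Qed.

Lemma vdotC x y : vdot x y = vdot y x.
Proof. by apply: eq_bigr => i _; rewrite mulrC. Qed.

Lemma vdotDl x y z : vdot (x + y) z = vdot x z + vdot y z.
Proof. by rewrite /vdot -big_split; apply: eq_bigr => i _; rewrite mxE mulrDl. Qed.

Lemma vdotZl a x y : vdot (a *: x) y = a * vdot x y.
Proof. by rewrite /vdot big_distrr; apply: eq_bigr => i _; rewrite mxE /= mulrA. Qed.

Lemma vsum_const a : vsum (const_mx a) = n%:R * a.
Proof.
rewrite /vsum; under eq_bigr => i _ do rewrite mxE.
by rewrite sumr_const card_ord mulr_natl.
Qed.

Lemma vdot_constl a x : vdot (const_mx a) x = a * vsum x.
Proof. by rewrite /vdot /vsum big_distrr; apply: eq_bigr => i _; rewrite mxE. Qed.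

Lemma vdot_ge0 x : 0 <= vdot x x.
Proof. by apply: sumr_ge0 => i _; rewrite -expr2 sqr_ge0. Qed.

(* Lagrange's identity. *)
Lemma vdot_cauchy_schwarz x y : vdot x y ^+ 2 <= vdot x x * vdot y y.
Proof.
have sum_ge0 : 0 <= \sum_i \sum_j
    (x ord0 i * y ord0 j - x ord0 j * y ord0 i) ^+ 2.
  by apply: sumr_ge0 => i _; apply: sumr_ge0 => j _; rewrite sqr_ge0.
suff E : \sum_i \sum_j (x ord0 i * y ord0 j - x ord0 j * y ord0 i) ^+ 2 =
    vdot x x * vdot y y + vdot y y * vdot x x - 2 * (vdot x y * vdot x y).
  by rewrite E in sum_ge0; nra.
rewrite /vdot !big_distrlr /= big_distrr /= -big_split -sumrB /=.
apply: eq_bigr => i _; rewrite big_distrr /= -big_split -sumrB /=.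
by apply: eq_bigr => j _; ring.
Qed.

(** Cauchy-Schwarz applied to the vectors minus their means, [c x] and [c y]. *)
Lemma centred_cauchy_schwarz x y : (0 < n)%N ->
  (vdot x y - vsum x * vsum y / n%:R) ^+ 2 <=
  (vdot x x - vsum x ^+ 2 / n%:R) * (vdot y y - vsum y ^+ 2 / n%:R).
Proof.
move=> n_gt0; have n0 : n%:R != 0 :> R by rewrite pnatr_eq0 -lt0n.
pose c z : 'rV[R]_n := z + const_mx (- (vsum z / n%:R)).
have cE z w : vdot (c z) (c w) = vdot z w - vsum z * vsum w / n%:R.
  rewrite /c vdotDl vdot_constl vsumD vsum_const (vdotC z) vdotDl vdot_constl.
  by rewrite (vdotC w); field.
by have := vdot_cauchy_schwarz (c x) (c y); rewrite !cE -!expr2.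
Qed.

(** Cauchy-Schwarz against the all-ones vector. *)
Lemma centred_ge0 x : (0 < n)%N -> 0 <= vdot x x - vsum x ^+ 2 / n%:R.
Proof.
move=> n_gt0; have n0 : 0 < n%:R :> R by rewrite ltr0n.
have := vdot_cauchy_schwarz x (const_mx 1).
rewrite (vdotC x) !vdot_constl vsum_const !mul1r mulr1 => h.
by rewrite subr_ge0 ler_pdivrMr.
Qed.

Lemma mpoly_fun_quad_sym a0 a1 a2 x :
  mpoly_fun (quad_sym n a0 a1 a2) x = quad_polar a0 a1 a2 x x.
Proof.
rewrite /mpoly_fun /quad_sym !mevalD !mevalZ mesym0E meval1.
set v := fun i => _.
have e1 : meval v (mesym n R 1) = vsum x.
  by rewrite mesym1E raddf_sum; apply: eq_bigr => i _; rewrite /= mevalXU.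
have := congr1 (meval v) (mesym1_sqr R n).
rewrite rmorphXn /= e1 mevalD mevalMn raddf_sum /=.
under eq_bigr => i _ do rewrite rmorphXn /= mevalXU expr2.
by rewrite -/(vdot x x) /quad_polar => h; rewrite -expr2 h; field.
Qed.

(** The weights sum to 1, so [(1, z)] is the same combination of [(1, x)] and [(1, y)], and
    bilinearity applies. *)
Lemma quad_polar_conv a0 a1 a2 t x y :
  let z := t *: x + (1 - t) *: y in
  quad_polar a0 a1 a2 z z =
  t ^+ 2 * quad_polar a0 a1 a2 x x + (1 - t) ^+ 2 * quad_polar a0 a1 a2 y y
  + 2 * t * (1 - t) * quad_polar a0 a1 a2 x y.
Proof.
rewrite /quad_polar /= !vdotDl !vdotZl !(vdotC _ (_ + _)) !vdotDl !vdotZl.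
by rewrite (vdotC y x) !vsumD !vsumZ; field.
Qed.

Lemma quad_polar_const a0 a1 a2 s t :
  quad_polar a0 a1 a2 (const_mx s) (const_mx t) =
  a0 + a1 / 2 * n%:R * (s + t) + a2 / 2 * (n%:R * (n%:R - 1)) * (s * t).
Proof. by rewrite /quad_polar vdot_constl !vsum_const; ring. Qed.

Lemma quad_polar_ge0 {a0 a1 a2 x y} : 0 <= a0 -> 0 <= a1 -> 0 <= a2 ->
  (forall i, 0 < x ord0 i) -> (forall i, 0 < y ord0 i) ->
  0 <= quad_polar a0 a1 a2 x y.
Proof.
move=> ha0 ha1 ha2 hx hy.
have sx : 0 <= vsum x by apply: sumr_ge0 => i _; apply/ltW.
have sy : 0 <= vsum y by apply: sumr_ge0 => i _; apply/ltW.
(* Termwise, [x_i y_i] is at most [x_i * vsum y]. *)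
have sxy : 0 <= vsum x * vsum y - vdot x y.
  rewrite subr_ge0 /vdot {1}/vsum big_distrl /=; apply: ler_sum => i _.
  rewrite ler_wpM2l ?(ltW (hx i)) // /vsum (bigD1 i) //= lerDl.
  by apply: sumr_ge0 => j _; apply/ltW.
have sD : 0 <= vsum x + vsum y by rewrite addr_ge0.
have [a10 a20] : 0 <= a1 / 2 /\ 0 <= a2 / 2 by rewrite !divr_ge0.
by rewrite /quad_polar !addr_ge0 // mulr_ge0.
Qed.

End Polarization.

(** * The reversed Cauchy-Schwarz inequality *)

Section ReversedCauchySchwarz.
Context {R : rcfType}.
Implicit Types a b c G H U V : R.

(* In terms of square roots [g], [g'], [u], [u'] of [G], [G'], [U], [U'], the
   bound is [(g^2 - c u^2)(g'^2 - c u'^2) <= (g g' - c u u')^2], whose defect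
   is [c (g u' - g' u)^2]. *)
Lemma reversed_cauchy_schwarz_sub c G G' H U U' V : 0 <= c ->
  0 <= U -> 0 <= U' -> c * U <= G -> c * U' <= G' -> 0 <= H ->
  G * G' <= H ^+ 2 -> V ^+ 2 <= U * U' ->
  (G - c * U) * (G' - c * U') <= (H - c * V) ^+ 2.
Proof.
move=> c0 U0 U'0 cUG cUG' H0 GH VU.
have G0 : 0 <= G by apply: le_trans cUG; rewrite mulr_ge0.
have G'0 : 0 <= G' by apply: le_trans cUG'; rewrite mulr_ge0.
set g := Num.sqrt G; set g' := Num.sqrt G'.
set u := Num.sqrt U; set u' := Num.sqrt U'.
have [gE g'E uE u'E] : [/\ G = g ^+ 2, G' = g' ^+ 2, U = u ^+ 2 & U' = u' ^+ 2].
  by rewrite !sqr_sqrtr.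
have [g0 g'0 u0 u'0] : [/\ 0 <= g, 0 <= g', 0 <= u & 0 <= u'].
  by rewrite !sqrtr_ge0.
have gH : g * g' <= H.
  by rewrite -(@ler_pXn2r _ 2) ?nnegrE ?mulr_ge0 // exprMn -gE -g'E.
have Vu : V <= u * u'.
  apply: le_trans (ler_norm _) _.
  rewrite -(@ler_pXn2r _ 2) ?nnegrE ?mulr_ge0 // real_normK ?num_real //.
  by rewrite exprMn -uE -u'E.
have cug : c * (u * u') <= g * g'.
  rewrite -(@ler_pXn2r _ 2) ?nnegrE ?mulr_ge0 //.
  have -> : (c * (u * u')) ^+ 2 = (c * U) * (c * U') by rewrite uE u'E; ring.
  by rewrite exprMn -gE -g'E ler_pM ?mulr_ge0.
have cVu : c * V <= c * (u * u') by rewrite ler_wpM2l.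
(* Since [0 <= g g' - c u u' <= H - c V], squaring preserves the order. *)
apply: (@le_trans _ _ ((g * g' - c * (u * u')) ^+ 2)); last first.
  by rewrite ler_pXn2r ?nnegrE //; lra.
rewrite -subr_ge0 gE g'E uE u'E.
have -> : (g * g' - c * (u * u')) ^+ 2
    - (g ^+ 2 - c * u ^+ 2) * (g' ^+ 2 - c * u' ^+ 2)
  = c * (g * u' - g' * u) ^+ 2 by ring.
by rewrite mulr_ge0 ?sqr_ge0.
Qed.

End ReversedCauchySchwarz.

Lemma quad_polar_reversed_cauchy_schwarz {R : realType} {n : nat}
    {a0 a1 a2 : R} {x y : 'rV[R]_n} : (0 < n)%N ->
  0 <= a0 -> 0 <= a1 -> 0 <= a2 ->
  0 <= n%:R * a1 ^+ 2 - 2 * (n%:R - 1) * a0 * a2 ->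
  (forall i, 0 < x ord0 i) -> (forall i, 0 < y ord0 i) ->
  quad_polar a0 a1 a2 x x * quad_polar a0 a1 a2 y y <=
  quad_polar a0 a1 a2 x y ^+ 2.
Proof.
move=> n_gt0 ha0 ha1 ha2 disc hx hy.
have n0 : n%:R != 0 :> R by rewrite pnatr_eq0 -lt0n.
have n1 : 1 <= n%:R :> R by rewrite ler1n.
(* [G s t] is the polar form at the constant vectors with coordinate sums [s] and [t]. *)
pose G (s t : R) := a0 + a1 / 2 * (s + t) + a2 / 2 * (1 - n%:R^-1) * (s * t).
have polarE (z w : 'rV[R]_n) : quad_polar a0 a1 a2 z w =
    G (vsum z) (vsum w) - a2 / 2 * (vdot z w - vsum z * vsum w / n%:R).
  by rewrite /G /quad_polar; field.
have sum_ge0 (z : 'rV[R]_n) : (forall i, 0 < z ord0 i) -> 0 <= vsum z.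
  by move=> hz; apply: sumr_ge0 => i _; apply/ltW.
have fx := quad_polar_ge0 ha0 ha1 ha2 hx hx.
have fy := quad_polar_ge0 ha0 ha1 ha2 hy hy.
rewrite !polarE -!expr2 in fx fy *.
apply: reversed_cauchy_schwarz_sub.
- by rewrite divr_ge0.
- exact: centred_ge0.
- exact: centred_ge0.
(* This bound and the next are the nonnegativity of [f x] and [f y]. *)
- by rewrite -subr_ge0.
- by rewrite -subr_ge0.
- have ? : 0 <= 1 - n%:R^-1 :> R by rewrite subr_ge0 invf_le1 ?ltr0n.
  have [sx sy] := (sum_ge0 x hx, sum_ge0 y hy).
  have [? ?] : 0 <= a1 / 2 /\ 0 <= a2 / 2 by rewrite !divr_ge0.
  by rewrite /G; do ![by [] | apply: addr_ge0 | apply: mulr_ge0].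
- rewrite -subr_ge0.
  have -> : G (vsum x) (vsum y) ^+ 2
      - G (vsum x) (vsum x) * G (vsum y) (vsum y)
    = (n%:R * a1 ^+ 2 - 2 * (n%:R - 1) * a0 * a2) / (4 * n%:R)
      * (vsum x - vsum y) ^+ 2.
    by rewrite /G; field.
  by rewrite mulr_ge0 ?sqr_ge0 // divr_ge0 ?mulr_ge0.
- exact: centred_cauchy_schwarz.
Qed.

(** * Concavity of [sqrt f] and the discriminant *)

Lemma sqrt_concave_of_disc (R : realType) (n : nat) (a0 a1 a2 : R) :
  (0 < n)%N -> 0 <= a0 -> 0 <= a1 -> 0 <= a2 ->
  0 <= n%:R * a1 ^+ 2 - 2 * (n%:R - 1) * a0 * a2 ->
  concave_on (@pos_orthant R n)
    (fun x => Num.sqrt (mpoly_fun (quad_sym n a0 a1 a2) x)).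
Proof.
move=> n_gt0 ha0 ha1 ha2 disc t x y; rewrite !inE => hx hy.
rewrite -convN lerN2.
change (t%:inum * Num.sqrt (mpoly_fun (quad_sym n a0 a1 a2) x)
  + (1 - t%:inum) * Num.sqrt (mpoly_fun (quad_sym n a0 a1 a2) y)
  <= Num.sqrt (mpoly_fun (quad_sym n a0 a1 a2)
       (t%:inum *: (x : 'rV[R]_n) + (1 - t%:inum) *: (y : 'rV[R]_n)))).
have t0 : 0 <= t%:inum :> R by [].
have t1 : 0 <= 1 - t%:inum :> R by rewrite subr_ge0.
move: (t%:inum : R) t0 t1 => {}t t0 t1.
rewrite !mpoly_fun_quad_sym quad_polar_conv.
have fx := quad_polar_ge0 ha0 ha1 ha2 hx hx.
have fy := quad_polar_ge0 ha0 ha1 ha2 hy hy.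
have fxy := quad_polar_ge0 ha0 ha1 ha2 hx hy.
have := quad_polar_reversed_cauchy_schwarz n_gt0 ha0 ha1 ha2 disc hx hy.
move: (quad_polar _ _ _ x x) (quad_polar _ _ _ y y) (quad_polar _ _ _ x y)
  fx fy fxy => F F' B F0 F'0 B0 FB.
(* After squaring the concavity inequality, the two sides differ only in their cross terms, which
   this bound compares. *)
have FB' : Num.sqrt F * Num.sqrt F' <= B.
  by rewrite -sqrtrM // -(ger0_norm B0) -sqrtr_sqr ler_wsqrtr.
rewrite -[leLHS]ger0_norm ?addr_ge0 ?mulr_ge0 ?sqrtr_ge0 // -sqrtr_sqr.
apply: ler_wsqrtr.
have -> : (t * Num.sqrt F + (1 - t) * Num.sqrt F') ^+ 2 =
  t ^+ 2 * Num.sqrt F ^+ 2 + (1 - t) ^+ 2 * Num.sqrt F' ^+ 2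
  + 2 * t * (1 - t) * (Num.sqrt F * Num.sqrt F') by ring.
by rewrite !sqr_sqrtr // lerD2l ler_wpM2l // !mulr_ge0.
Qed.

(** Midpoint concavity between two distinct diagonal points is enough; the vectors of ones and of
    twos are used. *)
Lemma disc_of_sqrt_concave (R : realType) (n : nat) (a0 a1 a2 : R) :
  (0 < n)%N -> 0 <= a0 -> 0 <= a1 -> 0 <= a2 ->
  concave_on (@pos_orthant R n)
    (fun x => Num.sqrt (mpoly_fun (quad_sym n a0 a1 a2) x)) ->
  0 <= n%:R * a1 ^+ 2 - 2 * (n%:R - 1) * a0 * a2.
Proof.
move=> n_gt0 ha0 ha1 ha2 conc.
have half01 : Itv.spec (@Itv.num_sem R) (Itv.Real `[0%Z, 1%Z]) (2^-1 : R).
  by rewrite /= /Itv.num_sem num_real /= in_itv /=; lra.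
pose x : 'rV[R]_n := const_mx 1; pose y : 'rV[R]_n := const_mx 2.
have hx i : 0 < x ord0 i by rewrite mxE.
have hy i : 0 < y ord0 i by rewrite mxE.
have := conc (Itv.mk half01) x y; rewrite !inE => /(_ hx hy).
rewrite -convN lerN2.
move=> h; have {h} : 2^-1 * Num.sqrt (mpoly_fun (quad_sym n a0 a1 a2) x)
  + (1 - 2^-1) * Num.sqrt (mpoly_fun (quad_sym n a0 a1 a2) y)
  <= Num.sqrt (mpoly_fun (quad_sym n a0 a1 a2) (2^-1 *: x + (1 - 2^-1) *: y)).
  exact: h.
rewrite !mpoly_fun_quad_sym quad_polar_conv.
have fx := quad_polar_ge0 ha0 ha1 ha2 hx hx.
have fy := quad_polar_ge0 ha0 ha1 ha2 hy hy.
have fxy := quad_polar_ge0 ha0 ha1 ha2 hx hy.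
have E : quad_polar a0 a1 a2 x y ^+ 2
    - quad_polar a0 a1 a2 x x * quad_polar a0 a1 a2 y y
  = n%:R / 4 * (n%:R * a1 ^+ 2 - 2 * (n%:R - 1) * a0 * a2).
  by rewrite !quad_polar_const; field.
have n0 : 0 < n%:R / 4 :> R by rewrite divr_gt0 ?ltr0n.
move=> h; rewrite -(pmulr_rge0 _ n0) -E subr_ge0 {E}; move: h.
move: (quad_polar _ _ _ x x) (quad_polar _ _ _ y y) (quad_polar _ _ _ x y)
  fx fy fxy => F F' B F0 F'0 B0.
have [r0 r'0] := (sqrtr_ge0 F, sqrtr_ge0 F').
have [rE r'E] : F = Num.sqrt F ^+ 2 /\ F' = Num.sqrt F' ^+ 2.
  by rewrite !sqr_sqrtr.
move: (Num.sqrt F) (Num.sqrt F') r0 r'0 rE r'E => r r' r0 r'0 -> ->.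
have lhs0 : 0 <= 2^-1 * r + (1 - 2^-1) * r' by lra.
set S := (X in Num.sqrt X) => h.
have S0 : 0 <= S by rewrite /S; nra.
have {h} : (2^-1 * r + (1 - 2^-1) * r') ^+ 2 <= S.
  by rewrite -(sqr_sqrtr S0) ler_pXn2r ?nnegrE ?sqrtr_ge0.
(* The goal reduces to [r * r' <= B], which is the squared midpoint inequality with the common
   squares cancelled. *)
rewrite /S => h; rewrite -exprMn ler_pXn2r ?nnegrE ?mulr_ge0 //.
have half : 1 - 2^-1 = 2^-1 :> R by field.
by rewrite half in h; nra.
Qed.

(** * Real-rootedness of polynomials of degree at most 2 *)

Lemma real_rooted_quadratic (R : realType) (A B C : R) :
  real_rooted (A%:P + B *: 'X + C *: 'X^2) <-> 0 <= B ^+ 2 - 4 * A * C.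
Proof.
set p := _ + _.
have rootE (u v : R) : root (map_poly (real_complex R) p) (Complex u v) <->
    A + B * u + C * (u ^+ 2 - v ^+ 2) = 0 /\ B * v + 2 * C * u * v = 0.
  rewrite /root /p !rmorphD /= map_polyC !map_polyZ map_polyX map_polyXn.
  rewrite !hornerE /=; split.
    move/eqP; simpc => -[h1 h2]; split; [rewrite -h1 | rewrite -h2]; ring.
  move=> [h1 h2]; apply/eqP; simpc; congr Complex;
    [rewrite -h1 | rewrite -h2]; ring.
have coef2 : p`_2 = C by rewrite /p !coefE /=; ring.
split=> [[sz | rr] | disc].
- have -> : C = 0 by rewrite -coef2 nth_default // (leq_trans sz).
  by rewrite mulr0 subr0 sqr_ge0.
- rewrite leNgt; apply/negP => disc.
  (* If [C = 0], the discriminant is [B ^+ 2], which is not negative. The quadratic formula then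
     gives a nonreal root. *)
  have C0 : C != 0 by apply/eqP => C0; move: disc; rewrite C0; nra.
  have s0 : 0 < Num.sqrt (4 * A * C - B ^+ 2) by rewrite sqrtr_gt0; lra.
  have sE : Num.sqrt (4 * A * C - B ^+ 2) ^+ 2 = 4 * A * C - B ^+ 2.
    by rewrite sqr_sqrtr //; lra.
  have := rr (Complex (- B / (2 * C))
    (Num.sqrt (4 * A * C - B ^+ 2) / (2 * C))).
  have -> /= : root (map_poly (real_complex R) p)
      (Complex (- B / (2 * C)) (Num.sqrt (4 * A * C - B ^+ 2) / (2 * C))).
    apply/rootE; split; last by field.
    by rewrite [in X in _ - X]expr_div_n sE; field.
  move=> /(_ isT) /eqP; rewrite mulf_eq0 invr_eq0 mulf_eq0 (negbTE C0).
  by rewrite gt_eqF // pnatr_eq0.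
- have [/andP[/eqP B0 /eqP C0]|BC0] := boolP ((B == 0) && (C == 0)).
    by left; rewrite /p B0 C0 !scale0r !addr0 size_polyC_leq1.
  right=> -[u v] /rootE[h1 h2] /=; apply/eqP; apply: contraNT BC0 => v0.
  (* The imaginary part, divided by [v], gives [B]; the real part then gives [A = C (u^2 + v^2)], so
     the discriminant is [-4 (C v)^2], forcing [C = 0] and hence [B = 0]. *)
  have BE : B = - 2 * C * u by apply: (mulIf v0); lra.
  have C0 : C == 0.
    have Cv : (C * v) ^+ 2 <= 0 by nra.
    have := le_anti (introT andP (conj Cv (sqr_ge0 _))) => /eqP.
    by rewrite sqrf_eq0 mulf_eq0 (negbTE v0) orbF.
  by rewrite BE (eqP C0) mulr0 mul0r eqxx.
Qed.

Theorem theorem3p3 (R : realType) (n : nat) (a0 a1 a2 : R)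
    (hn : (1 <= n)%N) (ha0 : 0 <= a0) (ha1 : 0 <= a1) (ha2 : 0 <= a2) :
  let f := quad_sym n a0 a1 a2 in
  let fbar := diag_poly f in
  let sqrtf := fun x : 'rV[R]_n => Num.sqrt (mpoly_fun f x) in
  [/\ fbar = (a0 * 'C(n, 0)%:R)%:P + (a1 * 'C(n, 1)%:R) *: 'X
             + (a2 * 'C(n, 2)%:R) *: 'X^2,
      concave_on (@pos_orthant R n) sqrtf <-> real_rooted fbar
    & concave_on (@pos_orthant R n) sqrtf <->
      0 <= n%:R * a1 ^+ 2 - 2 * (n%:R - 1) * a0 * a2].
Proof.
move=> f fbar sqrtf.
have fbarE := diag_poly_quad_sym R n a0 a1 a2.
have concE : concave_on (@pos_orthant R n) sqrtf <->
    0 <= n%:R * a1 ^+ 2 - 2 * (n%:R - 1) * a0 * a2.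
  by split; [exact: disc_of_sqrt_concave | exact: sqrt_concave_of_disc].
split=> //; rewrite concE /fbar fbarE real_rooted_quadratic bin0 bin1.
have bin2E : 2 * 'C(n, 2)%:R = n%:R * (n%:R - 1) :> R.
  have := congr1 (fun k => k%:R : R) (mul_bin_diag n 1).
  by rewrite bin1 !natrM => <-; rewrite -subn1 natrB.
(* The discriminant of [fbar] is [n] times the quantity in the criterion, and [n > 0]. *)
have -> : (a1 * n%:R) ^+ 2 - 4 * (a0 * 1) * (a2 * 'C(n, 2)%:R) =
    n%:R * (n%:R * a1 ^+ 2 - 2 * (n%:R - 1) * a0 * a2).
  transitivity ((a1 * n%:R) ^+ 2 - 2 * a0 * a2 * (2 * 'C(n, 2)%:R)).
    by ring.
  by rewrite bin2E; ring.
by rewrite pmulr_rge0 // ltr0n.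
Qed.
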